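(* Assume that (i) for every group $g\in\mathcal G$, $U_g(t_g^{\max})\ge U_g^\star>0$; and (ii) there exists $\gamma>0$ such that the propensities satisfy $p^{\sigma_{q,g}^f(j)}>\gamma$ for all $g\in\mathcal G$, all $q\in\mathcal Q$ (and all relevance vectors), and all $j\in\{1,\dots,t_g^{\max}\}$. Let the clipping parameter be $\lambda=\sqrt m$, where $m$ is the number of logged requests, and let $\hat t_g$ be either $\hat t_g^{\mathrm{union}}$ or $\hat t_g^{\mathrm{mono}}$ (both computed, for each $m$, from the first $m$ logged requests with the lower bound $\hat U_g^-$ given in the context). Then for any group $g\in\mathcal G$ and any $\alpha\in(0,1)$, it holds almost surely that for any $\delta>0$ there exists $c>0$ such that for any $m>c$, $$U_g^\star-\delta<U_g(\hat t_g)<1+U_g^\star+\delta ,$$ and, even stronger than the second inequality, $$U_g(\hat t_g-1)<U_g^\star+\delta .$$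
   Context: There are $n$ items $d^1,\dots,d^n$ in an item space $\mathcal D$, and a family $\mathcal G$ of (possibly overlapping) groups of items. A recommendation request is a pair $(q,\mathbf r)$ drawn from a distribution $P_{Q,\mathbf R}$, where $q\in\mathcal Q$ is a query and $\mathbf r=(r^1,\dots,r^n)\in\{0,1\}^n$ is the vector of relevances of the items. A relevance model $f:\mathcal Q\times\mathcal D\to[0,1]$ is fixed. For a query $q$ and group $g$, $\sigma_{q,g}^f$ is a deterministic ranking of the items of $g$ by decreasing value of $f(q,\cdot)$; $\sigma_{q,g}^f(j)$ is the index of the item of $g$ ranked at position $j$. For each $g$, $t_g^{\max}$ is a positive integer (at most the number of items in $g$) and $U_g^\star\in\mathbb R$ is a target. For $t\in\{0,1,\dots,t_g^{\max}\}$, $$U_g(t):=\mathbb E_{(q,\mathbf r)\sim P_{Q,\mathbf R}}\Big[\sum_{j=1}^{t} r^{\sigma_{q,g}^f(j)}\Big].$$ Logged data: for a fixed logging policy $\pi_0$, for each $i=1,2,\dots$, independently, $(Q_i,\mathbf R_i)\sim P_{Q,\mathbf R}$, and a user observation vector $\mathbf O_i\in\{0,1\}^n$ is drawn from a conditional distribution $P^{\pi_0}_{\mathbf O\mid Q,\mathbf R}$ given $(Q_i,\mathbf R_i)$ (the same for all $i$). The user feedback on item $j$ is $C_i^j=O_i^jR_i^j$. The propensity is $p_i^j:=\Pr(O_i^j=1\mid Q_i,\mathbf R_i;\pi_0)$, a function of $(Q_i,\mathbf R_i)$ which is assumed known; $p^j$ denotes the propensity of item $j$ for a generic request. For $m>1$,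 $\lambda>0$, put $$Z_i^{g,t}=\sum_{j=1}^t\min\Big(\lambda,\frac1{p_i^{\sigma_{Q_i,g}^f(j)}}\Big)C_i^{\sigma_{Q_i,g}^f(j)},\qquad \hat U_{g,\lambda}^{\mathrm{CIPW}}(t)=\frac1m\sum_{i=1}^m Z_i^{g,t},$$ $$V_m(\mathbf Z^{g,t})=\frac1{m(m-1)}\sum_{1\le i<j\le m}\big(Z_i^{g,t}-Z_j^{g,t}\big)^2,$$ $$\hat U_g^-(t,\alpha)=\hat U_{g,\lambda}^{\mathrm{CIPW}}(t)-\sqrt{\frac{2V_m(\mathbf Z^{g,t})\ln(2/\alpha)}{m}}-\frac{7t\lambda\ln(2/\alpha)}{3(m-1)} .$$ Threshold selection rules (minimum over the empty set is defined to be $t_g^{\max}$): $$\hat t_g^{\mathrm{union}} := \min\Big\{t\in\{1,\dots,t_g^{\max}-1\} : \hat U_g^-\Big(t,\tfrac{\alpha}{t_g^{\max}-1}\Big)\ge U_g^\star\Big\},$$ $$\hat t_g^{\mathrm{mono}} := \min\Big\{t\in\{1,\dots,t_g^{\max}-1\} : \hat U_g^-(t',\alpha)\ge U_g^\star \ \text{ for all integers } t\le t'<t_g^{\max}\Big\}.$$ In $U_g(\hat t_g)$ the deterministic function $U_g$ is evaluated at the random integer $\hat t_g$. *)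

(* Defs.v *)
From HB Require Import structures.
From mathcomp Require Export all_boot all_order all_algebra.
From mathcomp Require Export finmap.
From mathcomp Require Export all_classical all_reals all_analysis.

Set Implicit Arguments.
Unset Strict Implicit.
Unset Printing Implicit Defensive.

Import Order.TTheory GRing.Theory Num.Theory.
Import numFieldNormedType.Exports.

Local Open Scope classical_set_scope.
Local Open Scope ring_scope.

(* [s 1, ..., s #|A|] lists the items of A by decreasing value of v.  Ties may
   be broken arbitrarily; the values of s at other positions are irrelevant. *)
Definition is_ranking (R : realType) (n : nat) (A : {set 'I_n}) (v : 'I_n -> R)
    (s : nat -> 'I_n) : Prop :=
  let l := [seq s j | j <- iota 1 #|A|] in
  perm_eq l (enum A) /\ sorted (fun k k' => v k' <= v k) l.

Definition mutually_independent (d d' : measure_display)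
    (Omega : measurableType d) (T : measurableType d') (R : realType)
    (P : probability Omega R) (X : nat -> {RV P >-> T}) : Prop :=
  forall (J : {fset nat}) (A : nat -> set T),
    (forall i, measurable (A i)) ->
    P (\bigcap_(i in [set` J]) (X i @^-1` A i)) =
    (\prod_(i <- J) P (X i @^-1` A i))%E.

(* A request is a pair (query, relevance vector) in Q * n.-tuple bool. *)

Definition utility (d : measure_display) (Q : measurableType d) (R : realType)
    (n : nat) (PQR : probability (Q * n.-tuple bool)%type R)
    (s : Q -> nat -> 'I_n) (t : nat) : R :=
  fine ('E_PQR[(fun x => \sum_(1 <= j < t.+1) (tnth x.2 (s x.1 j))%:R)%R])%E.

(* The kernel K is the conditional law of the observation vector given the
   request, under the logging policy. *)
Definition propensity (d : measure_display) (Q : measurableType d)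
    (R : realType) (n : nat)
    (K : R.-pker (Q * n.-tuple bool)%type ~> n.-tuple bool)
    (j : 'I_n) (x : Q * n.-tuple bool) : R :=
  fine (K x [set o : n.-tuple bool | tnth o j]).

(* The law of ((Q_i, R_i), O_i) is the composition of PQR with K. *)
Definition has_logging_law (d d' : measure_display) (Omega : measurableType d)
    (Q : measurableType d') (R : realType) (n : nat)
    (P : probability Omega R)
    (PQR : probability (Q * n.-tuple bool)%type R)
    (K : R.-pker (Q * n.-tuple bool)%type ~> n.-tuple bool)
    (X : {RV P >-> (Q * n.-tuple bool * n.-tuple bool)%type}) : Prop :=
  forall (A : set (Q * n.-tuple bool)) (B : set (n.-tuple bool)),
    measurable A -> measurable B ->
    P (X @^-1` (A `*` B)) = (\int[PQR]_(x in A) K x B)%E.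

Definition feedback (R : realType) (Q : Type) (n : nat)
    (y : Q * n.-tuple bool * n.-tuple bool) (j : 'I_n) : R :=
  (tnth y.2 j)%:R * (tnth y.1.2 j)%:R.

(* Z^{g,t} for one log entry y = (q, r, o). *)
Definition clipped_gain (d : measure_display) (Q : measurableType d)
    (R : realType) (n : nat)
    (K : R.-pker (Q * n.-tuple bool)%type ~> n.-tuple bool)
    (s : Q -> nat -> 'I_n) (lambda : R) (t : nat)
    (y : Q * n.-tuple bool * n.-tuple bool) : R :=
  \sum_(1 <= j < t.+1)
    Num.min lambda (propensity K (s y.1.1 j) y.1)^-1
      * feedback R y (s y.1.1 j).

(* Samples are indexed from 0: Z_1, ..., Z_m are z 0, ..., z m.-1. *)

Definition sample_mean (R : realType) (m : nat) (z : nat -> R) : R :=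
  (\sum_(i < m) z i) / m%:R.

Definition sample_variance (R : realType) (m : nat) (z : nat -> R) : R :=
  (\sum_(i < m) \sum_(j < m | (i < j)%N) (z i - z j) ^+ 2)
    / (m%:R * (m%:R - 1)).

Definition utility_lower_bound (d : measure_display) (Q : measurableType d)
    (R : realType) (n : nat)
    (K : R.-pker (Q * n.-tuple bool)%type ~> n.-tuple bool)
    (s : Q -> nat -> 'I_n) (lambda : R) (m : nat)
    (y : nat -> Q * n.-tuple bool * n.-tuple bool) (t : nat) (alpha : R) : R :=
  let z i := clipped_gain K s lambda t (y i) in
  sample_mean m z
  - Num.sqrt (2 * sample_variance m z * ln (2 / alpha) / m%:R)
  - 7 * t%:R * lambda * ln (2 / alpha) / (3 * (m%:R - 1)).

(* In both rules, L t alpha is the lower bound on the utility at threshold t.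
   The neutral value tmax of the iterated minn is the minimum of the empty set;
   it exceeds every t in the range, so it does not affect other minima. *)

Definition union_threshold (R : realType) (tmax : nat) (Ustar alpha : R)
    (L : nat -> R -> R) : nat :=
  \big[minn/tmax]_(1 <= t < tmax | Ustar <= L t (alpha / (tmax%:R - 1))) t.

Definition mono_threshold (R : realType) (tmax : nat) (Ustar alpha : R)
    (L : nat -> R -> R) : nat :=
  \big[minn/tmax]_(1 <= t < tmax |
     [forall t' : 'I_tmax, (t <= t')%N ==> (Ustar <= L t' alpha)]) t.

(* Main.v *)
From HB Require Import structures.
Require Import Defs.
From mathcomp Require Import ring lra zify measurable_realfun.

(** Almost surely the lower confidence bound at each fixed threshold converges
    to the true utility; this decides both rules in the limit.  Indeed, once
    [sqrt m] exceeds the bound [1 / gamma] on the inverse propensities, clipping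
    is inactive and the gains are bounded, independent and identically
    distributed with mean [U t] (inverse propensity weighting is unbiased), so
    their averages converge by the strong law of large numbers.  The variance
    penalty is [O(sqrt (1 / m))] because the sample variance is bounded, and the
    last penalty is [O(sqrt m / m)].  A selected threshold [t] below the
    maximum has bound at least [Ustar], while under either rule the bound at
    [t - 1] is below [Ustar]; finally [U t <= U (t - 1) + 1]. *)

Set Implicit Arguments.
Unset Strict Implicit.
Unset Printing Implicit Defensive.

Import Order.TTheory GRing.Theory Num.Theory.
Import numFieldNormedType.Exports.

Local Open Scope classical_set_scope.
Local Open Scope ring_scope.

(** * Threshold selection *)

(** The first three clauses hold for the neutral value and for every listed index, and [minn]
    preserves them. The last holds because any listed index satisfying [p] bounds the minimum from
    above. *)
Lemma bigminn_spec (T : nat) (p : pred nat) :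
  let t := \big[minn/T]_(1 <= t < T | p t) t in
  [/\ (t <= T)%N, (0 < T -> 0 < t)%N, (t < T)%N -> p t
    & forall j, (0 < j < t)%N -> ~~ p j].
Proof.
move=> t.
have [tT [t0 pt]] : (t <= T)%N /\ ((0 < T -> 0 < t)%N /\ ((t < T)%N -> p t)).
  rewrite /t big_nat_cond; apply: (big_ind (fun t => (t <= T)%N /\
      ((0 < T -> 0 < t)%N /\ ((t < T)%N -> p t)))).
  - by rewrite ltnn.
  - by move=> x y hx hy; rewrite /minn; case: ifP.
  - by move=> i /andP[/andP[i0 iT] pi]; rewrite (ltnW iT).
split=> // j /andP[j0 jt]; apply/negP => pj.
have jT : (j < T)%N by exact: leq_trans tT.
suff : (t <= j)%N by rewrite leqNgt jt.
have : j \in index_iota 1 T by rewrite mem_index_iota j0.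
rewrite /t; elim: (index_iota 1 T) => // i s IH.
rewrite inE big_cons => /predU1P[<-|/IH {}IH]; first by rewrite pj geq_minl.
by case: ifP => // _; rewrite geq_min IH orbT.
Qed.

(** What both rules share, and all that the limit argument uses of them. The guard [t < tmax] leaves
    out the default value, whose bound may miss the target; [1 < t] leaves out the predecessor 0,
    which is not a candidate. *)
Definition threshold_property (R : realType) (tmax : nat) (Ustar : R)
    (L : nat -> R) (t : nat) :=
  [/\ (0 < t <= tmax)%N, (t < tmax)%N -> Ustar <= L t
    & (1 < t)%N -> L (t - 1)%N < Ustar].

Lemma union_threshold_property (R : realType) (tmax : nat) (Ustar alpha : R)
    (L : nat -> R -> R) : (0 < tmax)%N ->
  threshold_property tmax Ustar (L ^~ (alpha / (tmax%:R - 1)))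
    (union_threshold tmax Ustar alpha L).
Proof.
move=> T0; rewrite /union_threshold.
have [tT /(_ T0) t0 pt minp] := bigminn_spec tmax
  (fun t => Ustar <= L t (alpha / (tmax%:R - 1))).
split=> //; first by rewrite t0.
move=> t1; rewrite ltNge; apply: minp.
by rewrite subn_gt0 t1/= subn1 prednK.
Qed.

(** Rejection of [t - 1] yields some [t' >= t - 1] whose bound is below the target. All indices from
    [t] up to [tmax] (excluded) pass, so [t'] must be [t - 1] itself. *)
Lemma mono_threshold_property (R : realType) (tmax : nat) (Ustar alpha : R)
    (L : nat -> R -> R) : (0 < tmax)%N ->
  threshold_property tmax Ustar (L ^~ alpha)
    (mono_threshold tmax Ustar alpha L).
Proof.
move=> T0; rewrite /mono_threshold.
have [] := bigminn_spec tmax (fun t =>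
  [forall t' : 'I_tmax, (t <= t')%N ==> (Ustar <= L t' alpha)]).
set t := \big[minn/tmax]_(1 <= t < tmax | _) t.
move=> tT /(_ T0) t0 pt minp.
have pt' t' : (t <= t' < tmax)%N -> Ustar <= L t' alpha.
  move=> /andP[tt' t'T]; move: (pt (leq_ltn_trans tt' t'T)).
  by move=> /forallP/(_ (Ordinal t'T))/implyP; exact.
split=> //; first by rewrite t0.
  by move=> tT'; apply: pt'; rewrite leqnn.
move=> t1; have : (0 < t - 1 < t)%N.
  by rewrite subn_gt0 t1/= subn1 prednK.
move=> /minp/forallPn[t' /=]; rewrite negb_imply -ltNge => /andP[tt'].
case: (ltnP t' t) => [t't|tt'' Lt']; last first.
  by move: Lt'; rewrite ltNge pt'// tt'' ltn_ord.
suff -> : (t - 1)%N = t' by [].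
by apply/eqP; rewrite eqn_leq tt' subn1 -ltnS prednK.
Qed.

(** * Deterministic convergence of averages and lower bounds *)

Lemma sqrt_floor (m : nat) : (0 < m)%N ->
  exists k, (k.+1 ^ 2 <= m < k.+2 ^ 2)%N.
Proof.
elim: m => // -[_ _|m IH _]; first by exists 0%N.
have [//|k /andP[km mk]] := IH.
have [h|h] := ltnP m.+2 (k.+2 ^ 2); first by exists k; rewrite h (leq_trans km).
exists k.+1; rewrite h/=; apply: leq_ltn_trans (_ : (k.+2 ^ 2 < _)%N) => //.
by rewrite ltn_sqr.
Qed.

(* The nearest square [k^2] below [m] is within [2 k] of [m], so it changes the
   sum by at most [2 k B = o(m)]. *)
Lemma sample_mean_cvg0_of_squares (R : realType) (B : R) (d : nat -> R) :
  (forall i, `|d i| <= B) ->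
  sample_mean (k.+1 ^ 2) d @[k --> \oo] --> 0 ->
  sample_mean m d @[m --> \oo] --> 0.
Proof.
move=> dB /cvgr0Pnorm_le sq0; apply/cvgr0Pnorm_le => e e0.
have B0 : 0 <= B by exact: le_trans (dB 0%N).
have e20 : 0 < e / 2 by rewrite divr_gt0.
have [N _ hN] := sq0 _ e20.
(* [N] bounds the average along squares by [e / 2]; the other term gives [4 * B / e <= k.+1], so
   that the remainder [2 * k.+1 * B] is at most [e / 2 * k.+1 ^ 2]. *)
pose M := maxn N (Num.truncn (4 * B / e)).+1.
exists (M.+1 ^ 2)%N => // m /= Mm.
have m0 : (0 < m)%N by apply: leq_trans Mm.
have [k /andP[km mk]] := sqrt_floor m0.
have Mk : (M <= k)%N.
  have := leq_ltn_trans Mm mk.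
  by rewrite ltn_sqr !ltnS.
have {hN} := hN k (leq_trans (leq_maxl _ _) Mk).
have {Mk} : 4 * B / e <= k.+1%:R.
  apply: ltW; apply: (lt_le_trans (truncnS_gt _)).
  by rewrite ler_nat (leq_trans (leq_maxr N _))// (leq_trans Mk).
rewrite /sample_mean ler_pdivrMr// => hB.
rewrite !normrM !normfV !normr_nat.
have k20 : 0 < (k.+1 ^ 2)%:R :> R by rewrite ltr0n expn_gt0.
rewrite ler_pdivrMr// ler_pdivrMr ?ltr0n// => hS.
have -> : \sum_(i < m) d i = \sum_(i < k.+1 ^ 2) d i +
    \sum_(k.+1 ^ 2 <= i < m) d i.
  by rewrite -!(big_mkord xpredT d) -big_cat_nat.
apply: (le_trans (ler_normD _ _)).
(* Since [m < k.+2 ^ 2], at most [2 * k.+1] terms remain. *)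
have : `|\sum_(k.+1 ^ 2 <= i < m) d i| <= (2 * k.+1)%:R * B.
  apply: le_trans (ler_norm_sum _ _ _) _.
  apply: le_trans (ler_sum _ (fun i _ => dB i)) _.
  rewrite sumr_const_nat -[leLHS]mulr_natl ler_wpM2r// ler_nat.
  by rewrite leq_subLR -ltnS (leq_trans mk)// -addnS; lia.
move=> hR; apply: (le_trans (lerD hS hR)).
apply: (@le_trans _ _ (e * (k.+1 ^ 2)%:R)); last first.
  by rewrite ler_wpM2l ?ler_nat// ltW.
rewrite natrM natrX.
have k0 : 0 <= k.+1%:R :> R by [].
nra.
Qed.

(** Each squared difference is at most [(2 * B) ^+ 2]. Counting all [m ^ 2] pairs and using
    [m <= 2 * (m - 1)] gives the constant 8. *)
Lemma sample_variance_bound (R : realType) (B : R) (z : nat -> R) (m : nat) :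
  (1 < m)%N -> (forall i, `|z i| <= B) ->
  0 <= sample_variance m z <= 8 * B ^+ 2.
Proof.
move=> m1 zB; have mR : 2 <= m%:R :> R by rewrite ler_nat.
have D0 : 0 < m%:R * (m%:R - 1) :> R by rewrite mulr_gt0; lra.
apply/andP; split.
  rewrite divr_ge0 ?(ltW D0)//; apply: sumr_ge0 => i _.
  by apply: sumr_ge0 => j _; rewrite sqr_ge0.
rewrite ler_pdivrMr//.
apply: (@le_trans _ _ (\sum_(i < m) \sum_(j < m) (2 * B) ^+ 2)).
  apply: ler_sum => i _; rewrite big_mkcond; apply: ler_sum => j _.
  case: ifP => _; last exact: sqr_ge0.
  move: (zB i) (zB j); rewrite !ler_norml => /andP[? ?] /andP[? ?].
  by rewrite -subr_ge0 subr_sqr mulr_ge0//; lra.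
have sumE (x : R) : \sum_(i < m) x = m%:R * x.
  by rewrite sumr_const card_ord mulr_natl.
rewrite !sumE.
have -> : (2 * B) ^+ 2 = 4 * B ^+ 2 by ring.
have := sqr_ge0 B; move: (B ^+ 2) => C C0.
have := mulr_ge0 (ler0n R m) C0; nra.
Qed.

Lemma cvg0_bounded_mul (R : realType) (C : R) (f g : nat -> R) :
  (forall m, (1 < m)%N -> `|f m| <= C * g m) ->
  g m @[m --> \oo] --> 0 -> f m @[m --> \oo] --> 0.
Proof.
move=> fg g0; apply/norm_cvg0P.
apply: (@squeeze_cvgr _ _ _ _ (cst 0) (fun m => C * g m)).
- exists 2%N => // m /= m1; rewrite normr_ge0/=; exact: fg.
- exact: cvg_cst.
- by rewrite -[X in _ --> X](mulr0 C); apply: cvgMr.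
Qed.

Lemma invn_cvg0 (R : realType) : (m%:R^-1 : R) @[m --> \oo] --> 0.
Proof.
apply/gtr0_cvgV0; last exact: cvgr_idn.
by exists 1%N => // m /= m0; rewrite ltr0n.
Qed.

Lemma lower_bound_cvg (R : realType) (B u c : R) (t : nat) (W : nat -> R) :
  (forall i, `|W i| <= B) -> sample_mean m W @[m --> \oo] --> u ->
  sample_mean m W - Num.sqrt (2 * sample_variance m W * c / m%:R)
    - 7 * t%:R * Num.sqrt m%:R * c / (3 * (m%:R - 1)) @[m --> \oo] --> u.
Proof.
move=> WB Wu; rewrite -[u]subr0 -[u - 0]subr0; apply: cvgB; first apply: cvgB.
- exact: Wu.
- rewrite -sqrtr0; apply: continuous_cvg; first exact: sqrt_continuous.
  (* The radicand is bounded by a constant times [1 / m], and the square root is continuous at 0. *)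
  apply: (@cvg0_bounded_mul _ (2 * (8 * B ^+ 2) * `|c|)) (@invn_cvg0 R) => m m1.
  rewrite normrM normfV normr_nat ler_wpM2r ?invr_ge0//.
  rewrite normrM; apply: ler_wpM2r => //.
  have /andP[V0 VB] := sample_variance_bound m1 WB.
  by rewrite ger0_norm; [rewrite ler_wpM2l|rewrite mulr_ge0].
- have sV0 : Num.sqrt (m%:R^-1 : R) @[m --> \oo] --> 0.
    rewrite -sqrtr0; apply: continuous_cvg; first exact: sqrt_continuous.
    exact: invn_cvg0.
  apply: (@cvg0_bounded_mul _ (7 * t%:R * `|c|)) sV0 => m m1.
  have mR : 2 <= m%:R :> R by rewrite ler_nat.
  have m0 : 0 < m%:R :> R by lra.
  rewrite sqrtrV ?(ltW m0)//; have r0 : 0 < Num.sqrt m%:R :> R by rewrite sqrtr_gt0.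
  (* With [r] the square root of [m], [r ^+ 2 >= 2] gives [r ^+ 2 <= 3 * (r ^+ 2 - 1)], so the
     penalty is at most a constant times [1 / r]. *)
  have := sqr_sqrtr (ltW m0); move: (Num.sqrt _) r0 => r r0 rm.
  rewrite -rm in mR m0 *.
  have D0 : 0 < 3 * (r ^+ 2 - 1) by lra.
  rewrite normrM normfV [X in _ / X]gtr0_norm// normrM.
  rewrite ger0_norm ?mulr_ge0 ?(ltW r0)// ler_pdivrMr//.
  have -> : 7 * t%:R * r * `|c| = 7 * t%:R * `|c| * r^-1 * r ^+ 2.
    by field; rewrite gt_eqF.
  apply: ler_wpM2l; last by lra.
  by rewrite !mulr_ge0// invr_ge0 ltW.
Qed.

(** * Strong law of large numbers for bounded random variables *)

Lemma Rintegral_probability_cst (R : realType) (d : measure_display)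
    (T : measurableType d) (P : probability T R) (r : R) :
  \int[P]_w (cst r w) = r.
Proof.
have PT : fine (P [set: T]) = 1 by rewrite probability_setT.
by rewrite Rintegral_cst// PT mulr1.
Qed.

Lemma bounded_integrable (R : realType) (d : measure_display)
    (T : measurableType d) (P : probability T R) (B : R) (f : T -> R) :
  measurable_fun [set: T] f -> (forall x, `|f x| <= B) ->
  P.-integrable [set: T] (EFin \o f).
Proof.
move=> mf fB; apply: measurable_bounded_integrable => //.
  exact: le_lt_trans (probability_le1 P measurableT) (ltry 1).
exists B; split; first exact: num_real.
by move=> x Bx y _; exact: le_trans (fB y) (ltW Bx).
Qed.

(** After expansion of the square, the off-diagonal products integrate to zero and each of the [n]
    diagonal terms contributes at most [B ^+ 2]. *)
Lemma second_moment_sum (R : realType) (d : measure_display)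
    (T : measurableType d) (P : probability T R) (B : R) (D : nat -> T -> R) :
  (forall i, measurable_fun [set: T] (D i)) -> (forall i w, `|D i w| <= B) ->
  (forall i j, i != j -> \int[P]_w (D i w * D j w) = 0) ->
  forall n, \int[P]_w ((\sum_(i < n) D i w) ^+ 2) <= n%:R * B ^+ 2.
Proof.
move=> mD DB D0.
have mS n : measurable_fun [set: T] (fun w => \sum_(i < n) D i w).
  by apply: measurable_sum => i.
have SB n w : `|\sum_(i < n) D i w| <= n%:R * B.
  apply: le_trans (ler_norm_sum _ _ _) _.
  have -> : n%:R * B = \sum_(i < n) B by rewrite sumr_const card_ord mulr_natl.
  by apply: ler_sum => i _.
have iM (f g : T -> R) (F G : R) : measurable_fun [set: T] f ->
    (forall w, `|f w| <= F) -> measurable_fun [set: T] g ->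
    (forall w, `|g w| <= G) ->
    P.-integrable [set: T] (EFin \o (fun w => f w * g w)).
  move=> mf fF mg gG; apply: (@bounded_integrable _ _ _ _ (F * G)).
    exact: measurable_funM.
  by move=> w; rewrite normrM ler_pM.
have iSD n j := iM _ _ _ _ (mS n) (SB n) (mD j) (DB j).
(* A partial sum is orthogonal to every later term; this removes the cross terms in the induction on
   the number of summands. *)
have S0 j n : (n <= j)%N -> \int[P]_w ((\sum_(i < n) D i w) * D j w) = 0.
  elim: n => [_|n IH nj].
    under eq_Rintegral do rewrite big_ord0 mul0r.
    by rewrite Rintegral_cst// mul0r.
  under eq_Rintegral do rewrite big_ord_recr/= mulrDl.
  rewrite RintegralD//; [|exact: iSD|exact: iM (mD n) (DB n) (mD j) (DB j)].
  by rewrite IH ?(ltnW nj)// add0r D0// ltn_eqF.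
elim=> [|n IH].
  under eq_Rintegral do rewrite big_ord0 expr0n/=.
  by rewrite Rintegral_cst// !mul0r.
pose S w := \sum_(i < n) D i w.
have iSS : P.-integrable [set: T] (EFin \o (fun w => S w * S w)).
  exact: iM (mS n) (SB n) (mS n) (SB n).
have iDD : P.-integrable [set: T] (EFin \o (fun w => D n w * D n w)).
  exact: iM (mD n) (DB n) (mD n) (DB n).
have iSn : P.-integrable [set: T] (EFin \o (fun w => S w * D n w)).
  exact: iSD.
have -> : \int[P]_w ((\sum_(i < n.+1) D i w) ^+ 2) =
    \int[P]_w (S w * S w) + \int[P]_w (D n w * D n w).
  transitivity (\int[P]_w ((S w * S w + S w * D n w) +
                           (S w * D n w + D n w * D n w))).
    by apply: eq_Rintegral => w _; rewrite big_ord_recr/= -/(S w); ring.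
  rewrite RintegralD//; [|exact: (integrableD _ iSS iSn)
                         |exact: (integrableD _ iSn iDD)].
  by rewrite !RintegralD// S0// addr0 add0r.
rewrite -natr1 mulrDl mul1r; apply: lerD.
  by under eq_Rintegral do rewrite -expr2.
rewrite -[leRHS](Rintegral_probability_cst P).
apply: (le_Rintegral _ iDD) => //.
  exact: (@bounded_integrable _ _ _ _ `|B ^+ 2|).
move=> w _ /=; have := DB n w; rewrite ler_norml => /andP[? ?].
by rewrite -expr2 -subr_ge0 subr_sqr mulr_ge0//; lra.
Qed.

Lemma sum_inv_sqr_le (R : realType) (n : nat) :
  \sum_(k < n) ((k.+1 ^ 2)%:R^-1 : R) <= 2.
Proof.
(* The sharper bound is inductive: for [x >= 1], [1 / x ^ 2] is at most [2 / (x * (x + 1))], which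
   telescopes. *)
suff : \sum_(k < n) ((k.+1 ^ 2)%:R^-1 : R) <= 2 * (1 - n.+1%:R^-1).
  move=> /le_trans; apply; rewrite ler_piMr// gerBl invr_ge0//.
elim: n => [|n IH]; first by rewrite big_ord0 invr1 subrr mulr0.
rewrite big_ord_recr/=; apply: le_trans (lerD IH (lexx _)) _.
rewrite natrX -[n.+2%:R]natr1.
have : 1 <= n.+1%:R :> R by rewrite ler1n.
move: (n.+1%:R) => x x1.
rewrite -subr_ge0.
have -> : 2 * (1 - (x + 1)^-1) - (2 * (1 - x^-1) + (x ^+ 2)^-1) =
   (x - 1) / (x ^+ 2 * (x + 1)).
  by field; apply/andP; split; apply: lt0r_neq0; lra.
by rewrite divr_ge0 ?mulr_ge0 ?sqr_ge0//; lra.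
Qed.

(* The second moments of the averages along squares are [O(1 / k^2)], so the
   squared averages have an integrable, hence almost surely finite, sum. *)
Lemma uncorrelated_slln (R : realType) (d : measure_display)
    (T : measurableType d) (P : probability T R) (B : R) (D : nat -> T -> R) :
  (forall i, measurable_fun [set: T] (D i)) -> (forall i w, `|D i w| <= B) ->
  (forall i j, i != j -> \int[P]_w (D i w * D j w) = 0) ->
  {ae P, forall w, sample_mean m (D ^~ w) @[m --> \oo] --> 0}.
Proof.
move=> mD DB D0.
pose Y k w := sample_mean (k.+1 ^ 2) (D ^~ w) ^+ 2.
have mS n : measurable_fun [set: T] (fun w => \sum_(i < n) D i w).
  by apply: measurable_sum => i.
have mY k : measurable_fun [set: T] (Y k).
  by apply: measurable_funX; apply: measurable_funM.
have Y0 k w : 0 <= Y k w by exact: sqr_ge0.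
have B0 w : 0 <= B := le_trans (normr_ge0 _) (DB 0%N w).
have sqB n w : (\sum_(i < n) D i w) ^+ 2 <= (n%:R * B) ^+ 2.
  rewrite -[leLHS]real_normK ?num_real// lerXn2r ?nnegrE ?mulr_ge0 ?(B0 w)//.
  apply: le_trans (ler_norm_sum _ _ _) _.
  have -> : n%:R * B = \sum_(i < n) B by rewrite sumr_const card_ord mulr_natl.
  by apply: ler_sum => i _.
have intS n : P.-integrable [set: T]
    (EFin \o (fun w => (\sum_(i < n) D i w) ^+ 2)).
  apply: (@bounded_integrable _ _ _ _ ((n%:R * B) ^+ 2)) => [|w].
    exact: measurable_funX.
  by rewrite ger0_norm ?sqr_ge0.
(* The sum of [k.+1 ^ 2] terms has second moment at most [k.+1 ^ 2 * B ^+ 2]; averaging divides it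
   by [(k.+1 ^ 2) ^ 2]. *)
have intY k : (\int[P]_w (Y k w)%:E <= (B ^+ 2 * (k.+1 ^ 2)%:R^-1)%:E)%E.
  have -> : (\int[P]_w (Y k w)%:E = (\int[P]_w Y k w)%:E)%E.
    rewrite fineK// integrable_fin_num//.
    have := integrableZl measurableT ((k.+1 ^ 2)%:R^-2) (intS (k.+1 ^ 2)%N).
    apply: eq_integrable => // w _ /=.
    by rewrite /Y /sample_mean -EFinM expr_div_n mulrC.
  rewrite lee_fin /Y /sample_mean.
  under eq_Rintegral do rewrite expr_div_n mulrC.
  rewrite RintegralZl//.
  have := second_moment_sum mD DB D0 (k.+1 ^ 2)%N.
  have : 0 < (k.+1 ^ 2)%:R :> R by rewrite ltr0n expn_gt0.
  move: (k.+1 ^ 2)%:R (Rintegral _ _ _) => x I x0 xI.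
  by rewrite mulrC ler_pdivrMr ?exprn_gt0// expr2 mulrA mulfVK ?gt_eqF// mulrC.
pose F w := (\sum_(k <oo) (Y k w)%:E)%E.
have mYE k : measurable_fun [set: T] (fun w => (Y k w)%:E).
  exact/measurable_EFinP.
have F0 w : (0 <= F w)%E by apply: nneseries_ge0 => k _ _; rewrite lee_fin.
have intF : P.-integrable [set: T] F.
  apply/integrableP; split.
    apply: ge0_emeasurable_sum => k //.
    by move=> w _ _; rewrite lee_fin.
  under eq_integral do rewrite gee0_abs//.
  rewrite integral_nneseries//; last by move=> k w _; rewrite lee_fin.
  apply: (@le_lt_trans _ _ (2 * B ^+ 2)%:E); last exact: ltry.
  apply: lime_le.
    apply: is_cvg_nneseries => k _ _; apply: integral_ge0 => w _.
    by rewrite lee_fin.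
  apply: nearW => n; rewrite big_mkord.
  apply: (@le_trans _ _ (\sum_(k < n) (B ^+ 2 * (k.+1 ^ 2)%:R^-1)%:E)%E).
    by apply: lee_sum => k _.
  rewrite sumEFin lee_fin -mulr_sumr mulrC ler_wpM2r ?sqr_ge0//.
  exact: sum_inv_sqr_le.
have := integrable_ae measurableT intF.
apply: filterS => w /(_ I) Fw.
apply: (@sample_mean_cvg0_of_squares _ B) => [i|]; first exact: DB.
have : Y k w @[k --> \oo] --> 0.
  apply: cvg_series_cvg_0; apply: nnseries_is_cvg => //.
  by rewrite ltey_eq Fw.
(* Square roots turn the squared averages into absolute values of averages. *)
move=> /(continuous_cvg _ (@sqrt_continuous R _)); rewrite sqrtr0 => h.
apply/norm_cvg0P; apply: cvg_trans h; apply: near_eq_cvg.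
by apply: nearW => k; rewrite /= /Y sqrtr_sqr.
Qed.

Lemma Rintegral_distribution (R : realType) (d d' : measure_display)
    (Omega : measurableType d) (T : measurableType d') (P : probability Omega R)
    (X : {RV P >-> T}) (f : T -> R) :
  measurable_fun [set: T] f ->
  P.-integrable [set: Omega] (EFin \o (fun w => f (X w))) ->
  \int[distribution P X]_x f x = \int[P]_w f (X w).
Proof.
move=> mf intf; congr fine; rewrite integral_distribution//.
exact/measurable_EFinP.
Qed.

(** By independence the law of the pair agrees with the product of the marginal laws on rectangles,
    hence everywhere; Fubini then factors the integral. *)
Lemma Rintegral_indep_mul (R : realType) (d d' : measure_display)
    (Omega : measurableType d) (T : measurableType d') (P : probability Omega R)
    (X Y : {RV P >-> T}) (B : R) (f g : T -> R) :
  (forall A A', measurable A -> measurable A' ->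
     P (X @^-1` A `&` Y @^-1` A') = (P (X @^-1` A) * P (Y @^-1` A'))%E) ->
  measurable_fun [set: T] f -> measurable_fun [set: T] g ->
  (forall x, `|f x| <= B) -> (forall x, `|g x| <= B) ->
  \int[P]_w (f (X w) * g (Y w)) = \int[P]_w f (X w) * \int[P]_w g (Y w).
Proof.
move=> XY mf mg fB gB.
have mXY : measurable_fun [set: Omega] (fun w => (X w, Y w)).
  exact: measurable_fun_pair.
pose XYmixin := isMeasurableFun.Build _ _ _ _ _ mXY.
pose XYrv : {RV P >-> (T * T)%type} := HB.pack (fun w => (X w, Y w)) XYmixin.
pose h (z : (T * T)%type) := f z.1 * g z.2.
have mh : measurable_fun [set: (T * T)%type] h.
  apply: measurable_funM; apply: measurableT_comp => //.
have hB z : `|h z| <= B * B by rewrite normrM ler_pM.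
have mfX : measurable_fun [set: Omega] (fun w => f (X w)).
  exact: measurableT_comp.
have mgY : measurable_fun [set: Omega] (fun w => g (Y w)).
  exact: measurableT_comp.
rewrite -(Rintegral_distribution (X := X))//; last first.
  exact: (@bounded_integrable _ _ _ _ B).
rewrite -(Rintegral_distribution (X := Y))//; last first.
  exact: (@bounded_integrable _ _ _ _ B).
rewrite -[LHS](@Rintegral_distribution _ _ _ _ _ _ XYrv h)//; last first.
  apply: (@bounded_integrable _ _ _ _ (B * B)) => //.
  exact: measurable_funM.
transitivity (\int[(distribution P X \x distribution P Y)%E]_z h z).
  congr fine; apply: eq_measure_integral => A mA _; apply/esym.
  exact: product_measure_unique.
rewrite /Rintegral -integral12_prod_meas1//=; last first.
  exact: (@bounded_integrable _ _ _ _ (B * B)).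
have intfX : (distribution P X).-integrable [set: T] (EFin \o f).
  exact: (@bounded_integrable _ _ _ _ B).
have intgY : (distribution P Y).-integrable [set: T] (EFin \o g).
  exact: (@bounded_integrable _ _ _ _ B).
rewrite -RintegralZr//; congr fine; apply: eq_integral => x _.
rewrite /fubini_F /h/=; under eq_integral do rewrite EFinM.
by rewrite integralZl// EFinM fineK// integrable_fin_num.
Qed.

Lemma mutually_independent_pair (R : realType) (d d' : measure_display)
    (Omega : measurableType d) (T : measurableType d') (P : probability Omega R)
    (X : nat -> {RV P >-> T}) : mutually_independent X ->
  forall i j, i != j -> forall A A', measurable A -> measurable A' ->
  P (X i @^-1` A `&` X j @^-1` A') = (P (X i @^-1` A) * P (X j @^-1` A'))%E.
Proof.
move=> indX i j ij A A' mA mA'.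
have /= := indX [fset i; j]%fset (fun k => if k == i then A else A') _.
rewrite big_fsetU1/= ?inE// big_seq_fset1 eqxx eq_sym (negbTE ij) => <-.
  congr (P _); apply/seteqP; split => [w [iA jA'] k|w h].
    by rewrite /= !inE => /orP[/eqP ->|/eqP ->]; rewrite ?eqxx// eq_sym (negbTE ij).
  split.
    by have := h i; rewrite /= !inE eqxx; exact.
  by have := h j; rewrite /= !inE eqxx orbT eq_sym (negbTE ij); exact.
by move=> k; case: ifP.
Qed.

(** Independence makes the centred variables [g (X i)] uncorrelated, so their averages tend to 0;
    adding [mu] back gives the claim. *)
Lemma mutually_independent_slln (R : realType) (d d' : measure_display)
    (Omega : measurableType d) (T : measurableType d') (P : probability Omega R)
    (X : nat -> {RV P >-> T}) (B mu : R) (f : T -> R) :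
  mutually_independent X -> measurable_fun [set: T] f ->
  (forall x, `|f x| <= B) -> (forall i, \int[P]_w f (X i w) = mu) ->
  {ae P, forall w, sample_mean m (fun i => f (X i w)) @[m --> \oo] --> mu}.
Proof.
move=> indX mf fB fmu.
pose g x := f x - mu.
have mg : measurable_fun [set: T] g by exact: measurable_funB.
have gB x : `|g x| <= B + `|mu| by rewrite (le_trans (ler_normB _ _))// lerD.
have gX i : \int[P]_w g (X i w) = 0.
  rewrite RintegralB//; last 2 first.
  - by apply: (@bounded_integrable _ _ _ _ B) => //; exact: measurableT_comp.
  - exact: (@bounded_integrable _ _ _ _ `|mu|).
  by rewrite fmu (Rintegral_probability_cst P) subrr.
have : {ae P, forall w, sample_mean m (fun i => g (X i w)) @[m --> \oo] --> 0}.
  apply: (@uncorrelated_slln _ _ _ _ (B + `|mu|) (fun i w => g (X i w))) => //.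
    by move=> i; exact: measurableT_comp.
  move=> i j ij.
  rewrite (@Rintegral_indep_mul _ _ _ _ _ P (X i) (X j) (B + `|mu|))//.
    by rewrite gX mul0r.
  by move=> A A' mA mA'; exact: mutually_independent_pair.
apply: filterS => w gw; rewrite -[mu]add0r.
have : sample_mean m (fun i => g (X i w)) + mu @[m --> \oo] --> 0 + mu.
  by apply: cvgD => //; exact: cvg_cst.
(* The two sequences may differ at [m = 0], where the empty average is 0 instead of [mu]. *)
apply: cvg_trans; apply: near_eq_cvg; exists 1%N => // m /= m0.
rewrite /sample_mean /g sumrB sumr_const card_ord mulrBl -[mu *+ m]mulr_natr mulfK.
  by rewrite subrK.
by rewrite pnatr_eq0 -lt0n.
Qed.

(** * Integration against the joint law given by a kernel *)

Lemma pkernel_le1 (R : realType) (d1 d2 : measure_display)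
    (T1 : measurableType d1) (T2 : measurableType d2)
    (K : R.-pker T1 ~> T2) (x : T1) (B : set T2) :
  measurable B -> (K x B <= 1)%E.
Proof.
move=> mB; rewrite -(@prob_kernel _ _ _ _ _ K x).
by apply: le_measure; rewrite ?inE.
Qed.

Lemma pkernel_fin_num (R : realType) (d1 d2 : measure_display)
    (T1 : measurableType d1) (T2 : measurableType d2)
    (K : R.-pker T1 ~> T2) (x : T1) (B : set T2) :
  measurable B -> (K x B \is a fin_num)%E.
Proof.
move=> mB; rewrite ge0_fin_numE//.
exact: le_lt_trans (pkernel_le1 _ _ mB) (ltry 1).
Qed.

Section approximation_by_simple_functions.

Import HBNNSimple.

(** A simple function is a finite combination of indicators of its level sets, and on each level set
    the identity is the law of [X] on a rectangle. *)
Lemma integral_composition_nnsfun (R : realType) (d d1 d2 : measure_display)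
    (Omega : measurableType d) (T1 : measurableType d1)
    (T2 : measurableType d2) (P : probability Omega R)
    (mu : probability T1 R) (K : R.-pker T1 ~> T2)
    (X : {RV P >-> (T1 * T2)%type}) (B : set T2) (g : {nnsfun T1 >-> R}) :
  measurable B ->
  (forall A, measurable A ->
    P (X @^-1` (A `*` B)) = (\int[mu]_(x in A) K x B)%E) ->
  (\int[P]_w (g (X w).1 * \1_B (X w).2)%:E = \int[mu]_x ((g x)%:E * K x B))%E.
Proof.
move=> mB law.
have mK : measurable_fun [set: T1] (K ^~ B) by exact: measurable_kernel.
have mg k : measurable (g @^-1` [set k]) by exact: measurable_sfunP.
have mX A : measurable A -> measurable (X @^-1` (A `*` B)).
  move=> mA; rewrite -[X in measurable X]setTI.
  by apply: (measurable_funP X) => //; exact: measurableX.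
pose A k := g @^-1` [set k].
transitivity (\sum_(k \in range g)
    \int[P]_w (k * \1_(X @^-1` (A k `*` B)) w)%:E)%E.
  rewrite -ge0_integral_fsum//; last 2 first.
  - move=> k; apply/measurable_EFinP/measurable_funM => //.
    by apply: measurable_indic; exact: (mX _ (mg k)).
  (* For [k < 0] the level set is empty and the summand vanishes; the same case split recurs
     below. *)
  - move=> k w _; have [k0|k0] := leP 0 k.
      by rewrite lee_fin mulr_ge0 ?indicE.
    by rewrite /A preimage_nnfun0// set0X preimage_set0 indic0 mulr0.
  apply: eq_integral => w _; rewrite fimfunE !fsbig_finite//= sumEFin mulr_suml.
  congr (_%:E); apply: eq_bigr => k _; rewrite -mulrA; congr (_ * _).
  by rewrite !indicE -natrM mulnb -in_setX.
transitivity (\sum_(k \in range g) (\int[mu]_x (k%:E * (\1_(A k) x)%:E * K x B)))%E.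
  apply: eq_fsbigr => k _.
  rewrite (integralZl_indic _ (fun k => X @^-1` (A k `*` B)))//; last 2 first.
  - by move=> k0; rewrite /A preimage_nnfun0// set0X preimage_set0.
  - exact: (mX _ (mg k)).
  rewrite integral_indic// ?setIT; last exact: (mX _ (mg k)).
  transitivity (k%:E * \int[mu]_(x in A k) K x B)%E.
    by congr (_ * _)%E; exact: (law _ (mg k)).
  have [k0|k0] := leP 0 k; last first.
    rewrite /A preimage_nnfun0// integral_set0 mule0.
    by under eq_integral do rewrite indic0 mule0 mul0e; rewrite integral0.
  under [RHS]eq_integral do rewrite -muleA.
  rewrite ge0_integralZl//; last first.
    apply: emeasurable_funM => //; apply/measurable_EFinP.
    by apply: measurable_indic; exact: mg.
  congr (_ * _)%E; rewrite [LHS]integral_mkcond epatch_indic.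
  by apply: eq_integral => x _; rewrite muleC.
rewrite -ge0_integral_fsum//; last 2 first.
- move=> k; apply: emeasurable_funM => //.
  by apply/measurable_EFinP/measurable_funM => //; apply: measurable_indic;
  exact: mg.
- move=> k x _; rewrite mule_ge0//; exact: nnfun_muleindic_ge0.
apply: eq_integral => x _.
rewrite -ge0_mule_fsuml; last by move=> k; exact: nnfun_muleindic_ge0.
by rewrite [in RHS]fimfunE -fsumEFin.
Qed.

(** Both sides pass to the limit along increasing simple functions by monotone convergence. With [B]
    the event that a fixed item is observed, this integrates out the observation vector. *)
Lemma ge0_integral_composition (R : realType) (d d1 d2 : measure_display)
    (Omega : measurableType d) (T1 : measurableType d1)
    (T2 : measurableType d2) (P : probability Omega R)
    (mu : probability T1 R) (K : R.-pker T1 ~> T2)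
    (X : {RV P >-> (T1 * T2)%type}) (B : set T2) (h : T1 -> R) :
  measurable B ->
  (forall A, measurable A ->
    P (X @^-1` (A `*` B)) = (\int[mu]_(x in A) K x B)%E) ->
  measurable_fun [set: T1] h -> (forall x, 0 <= h x) ->
  (\int[P]_w (h (X w).1 * \1_B (X w).2)%:E = \int[mu]_x ((h x)%:E * K x B))%E.
Proof.
move=> mB law mh h0.
have mhE : measurable_fun [set: T1] (EFin \o h) by exact/measurable_EFinP.
pose g := nnsfun_approx measurableT mhE.
have gh x : (g n x)%:E @[n --> \oo] --> (h x)%:E.
  by apply: (cvg_nnsfun_approx measurableT mhE) => // y _; rewrite lee_fin.
have ndg x : {homo (fun n => g n x) : m n / (m <= n)%N >-> m <= n}.
  by move=> m n mn; exact/lefP/nd_nnsfun_approx.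
have mK : measurable_fun [set: T1] (K ^~ B) by exact: measurable_kernel.
have mX1 : measurable_fun [set: Omega] (fun w => (X w).1).
  exact: measurableT_comp.
have mX2 : measurable_fun [set: Omega] (fun w => \1_B (X w).2 : R).
  apply: (measurableT_comp (f := \1_B : T2 -> R)); first exact: measurable_indic.
  exact: measurableT_comp.
transitivity (limn (fun n => \int[P]_w (g n (X w).1 * \1_B (X w).2)%:E)%E).
  rewrite -monotone_convergence//.
  - apply: eq_integral => w _; apply/esym/cvg_lim => //.
    under eq_fun do rewrite EFinM.
    by rewrite EFinM; apply: cvgeZr.
  - move=> n; apply/measurable_EFinP/measurable_funM => //.
    exact: measurableT_comp.
  - by move=> n w _; rewrite lee_fin mulr_ge0 ?indicE.
  - by move=> w _ m n mn; rewrite lee_fin ler_wpM2r ?indicE//; exact: ndg.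
under eq_fun do rewrite (integral_composition_nnsfun _ mB law).
rewrite -monotone_convergence//.
- apply: eq_integral => x _; apply/cvg_lim => //.
  by apply: cvgeZr => //; exact: pkernel_fin_num.
- by move=> n; apply: emeasurable_funM => //; exact/measurable_EFinP.
- by move=> n x _; rewrite mule_ge0// lee_fin.
- by move=> x _ m n mn; rewrite lee_wpmul2r// lee_fin; exact: ndg.
Qed.

End approximation_by_simple_functions.

(** * Unbiasedness of inverse propensity weighting *)

(** On nonnegative reals the inverse is the power with exponent -1, a measurable function. *)
Lemma measurable_inv_nonneg (R : realType) (d : measure_display)
    (T : measurableType d) (f : T -> R) :
  measurable_fun [set: T] f -> (forall x, 0 <= f x) ->
  measurable_fun [set: T] (fun x => (f x)^-1).
Proof.
move=> mf f0; under eq_fun do rewrite -powR_inv1//.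
exact: (measurableT_comp (measurable_powR _)).
Qed.

Lemma measurable_tnth_true (n : nat) (k : 'I_n) :
  measurable [set o : n.-tuple bool | tnth o k].
Proof.
rewrite -[X in measurable X]setTI.
exact: (@measurable_tnth _ bool n k measurableT [set b : bool | b]).
Qed.

Lemma measurable_propensity (d : measure_display) (Q : measurableType d)
    (R : realType) (n : nat)
    (K : R.-pker (Q * n.-tuple bool)%type ~> n.-tuple bool) (k : 'I_n) :
  measurable_fun [set: (Q * n.-tuple bool)%type] (propensity K k).
Proof.
apply: (measurableT_comp (fine_measurable measurableT)).
exact: measurable_kernel (measurable_tnth_true k).
Qed.

(** The gain without clipping. It does not depend on [m], so the strong law applies to it, whereas
    the clipping level [Num.sqrt m%:R] changes with [m]. *)
Definition ipw_gain (d : measure_display) (Q : measurableType d)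
    (R : realType) (n : nat)
    (K : R.-pker (Q * n.-tuple bool)%type ~> n.-tuple bool)
    (s : Q -> nat -> 'I_n) (t : nat)
    (y : Q * n.-tuple bool * n.-tuple bool) : R :=
  \sum_(1 <= j < t.+1)
    (propensity K (s y.1.1 j) y.1)^-1 * feedback R y (s y.1.1 j).

(* [ipw_gain] involves the propensity of the random item at position [j]; the
   indicator of [s x.1 j = k] reduces it to fixed items [k], whose propensity is
   the kernel evaluated at a fixed set. *)
Definition ipw_weight (d : measure_display) (Q : measurableType d)
    (R : realType) (n : nat)
    (K : R.-pker (Q * n.-tuple bool)%type ~> n.-tuple bool)
    (s : Q -> nat -> 'I_n) (j : nat) (k : 'I_n) (x : Q * n.-tuple bool) : R :=
  (s x.1 j == k)%:R * ((propensity K k x)^-1 * (tnth x.2 k)%:R).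

Lemma ipw_gainE (d : measure_display) (Q : measurableType d)
    (R : realType) (n : nat)
    (K : R.-pker (Q * n.-tuple bool)%type ~> n.-tuple bool)
    (s : Q -> nat -> 'I_n) (t : nat) y :
  ipw_gain K s t y = \sum_(j < t) \sum_(k < n)
    ipw_weight K s j.+1 k y.1 * \1_[set o : n.-tuple bool | tnth o k] y.2.
Proof.
rewrite /ipw_gain big_add1/= big_mkord; apply: eq_bigr => j _.
rewrite (bigD1 (s y.1.1 j.+1))//= big1 ?addr0; last first.
  by move=> k /negbTE kj; rewrite /ipw_weight eq_sym kj !mul0r.
rewrite /ipw_weight eqxx mul1r /feedback indicE; set b := _ \in _.
have -> : b = tnth y.2 (s y.1.1 j.+1) by apply/idP/idP; rewrite inE.
by rewrite -mulrA; congr (_ * _); rewrite mulrC.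
Qed.

Lemma propensity_ge0 (d : measure_display) (Q : measurableType d)
    (R : realType) (n : nat)
    (K : R.-pker (Q * n.-tuple bool)%type ~> n.-tuple bool) (k : 'I_n) x :
  0 <= propensity K k x.
Proof. exact: fine_ge0. Qed.

Lemma ipw_weight_ge0 (d : measure_display) (Q : measurableType d)
    (R : realType) (n : nat)
    (K : R.-pker (Q * n.-tuple bool)%type ~> n.-tuple bool)
    (s : Q -> nat -> 'I_n) (j : nat) (k : 'I_n) x :
  0 <= ipw_weight K s j k x.
Proof. by rewrite mulr_ge0// mulr_ge0// invr_ge0 propensity_ge0. Qed.

Lemma measurable_nat_of_bool (R : realType) (d : measure_display)
    (T : measurableType d) (p : pred T) :
  measurable [set x | p x] ->
  measurable_fun [set: T] (fun x => (p x)%:R : R).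
Proof.
move=> mp; have -> : (fun x => (p x)%:R : R) = \1_[set x | p x].
  apply/funext => x; rewrite indicE; congr ((nat_of_bool _)%:R).
  by apply/idP/idP; rewrite inE.
exact: measurable_indic.
Qed.

Lemma measurable_relevance (R : realType) (d : measure_display)
    (Q : measurableType d) (n : nat) (k : 'I_n) :
  measurable_fun [set: (Q * n.-tuple bool)%type]
    (fun x => (tnth x.2 k)%:R : R).
Proof.
apply: measurable_nat_of_bool.
rewrite -[X in measurable X]setTI.
exact: (@measurable_snd _ _ _ _ measurableT _ (measurable_tnth_true k)).
Qed.

Lemma measurable_rank (R : realType) (d : measure_display)
    (Q : measurableType d) (n : nat) (s : Q -> nat -> 'I_n) (j : nat) k :
  measurable [set q | s q j = k] ->
  measurable_fun [set: (Q * n.-tuple bool)%type]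
    (fun x => (s x.1 j == k)%:R : R).
Proof.
move=> ms; apply: (@measurable_nat_of_bool _ _ _ (fun x => s x.1 j == k)).
have -> : [set x : Q * n.-tuple bool | s x.1 j == k] =
    [set: _] `&` (fst @^-1` [set q | s q j = k]).
  by apply/seteqP; split => x /=; [move=> /eqP|move=> [_ ->]].
exact: (@measurable_fst _ _ _ _ measurableT).
Qed.

Lemma measurable_ipw_weight (d : measure_display) (Q : measurableType d)
    (R : realType) (n : nat)
    (K : R.-pker (Q * n.-tuple bool)%type ~> n.-tuple bool)
    (s : Q -> nat -> 'I_n) (j : nat) (k : 'I_n) :
  measurable [set q | s q j = k] ->
  measurable_fun [set: (Q * n.-tuple bool)%type] (ipw_weight K s j k).
Proof.
move=> ms; apply: measurable_funM; first exact: measurable_rank.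
apply: measurable_funM; last exact: measurable_relevance.
apply: measurable_inv_nonneg; first exact: measurable_propensity.
exact: propensity_ge0.
Qed.

Lemma measurable_ipw_gain (d : measure_display) (Q : measurableType d)
    (R : realType) (n : nat)
    (K : R.-pker (Q * n.-tuple bool)%type ~> n.-tuple bool)
    (s : Q -> nat -> 'I_n) (t : nat) :
  (forall j k, (0 < j <= t)%N -> measurable [set q | s q j = k]) ->
  measurable_fun [set: (Q * n.-tuple bool * n.-tuple bool)%type]
    (ipw_gain K s t).
Proof.
move=> ms; rewrite (funext (@ipw_gainE _ _ _ _ K s t)).
apply: measurable_sum => j; apply: measurable_sum => k.
apply: measurable_funM.
  apply: (measurableT_comp (f := ipw_weight K s j.+1 k)) => //.
  by apply: measurable_ipw_weight; apply: ms; exact: ltn_ord.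
apply: (measurableT_comp (f := \1_[set o : n.-tuple bool | tnth o k] : _ -> R)).
  by apply: measurable_indic; exact: measurable_tnth_true.
exact: measurable_snd.
Qed.

Lemma ipw_gain_bound (d : measure_display) (Q : measurableType d)
    (R : realType) (n : nat)
    (K : R.-pker (Q * n.-tuple bool)%type ~> n.-tuple bool)
    (s : Q -> nat -> 'I_n) (t : nat) (gamma : R) : 0 < gamma ->
  (forall x j, (0 < j <= t)%N -> gamma < propensity K (s x.1 j) x) ->
  forall y, `|ipw_gain K s t y| <= t%:R * gamma^-1.
Proof.
move=> g0 gp y; rewrite /ipw_gain big_add1/= big_mkord.
apply: le_trans (ler_norm_sum _ _ _) _.
have -> : t%:R * gamma^-1 = \sum_(j < t) gamma^-1.
  by rewrite sumr_const card_ord mulr_natl.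
apply: ler_sum => j _; have gpj := gp y.1 j.+1 (ltn_ord j).
rewrite normrM -[leRHS]mulr1 ler_pM//.
  rewrite ger0_norm ?invr_ge0 ?propensity_ge0// lef_pV2 ?posrE ?ltW//.
  exact: lt_trans gpj.
by rewrite /feedback -natrM normr_nat lern1; do 2 case: (tnth _ _).
Qed.

(** The ranked item varies with the query; splitting by its value gives a finite sum of products of
    measurable functions. *)
Lemma measurable_ranked_relevance (R : realType) (d : measure_display)
    (Q : measurableType d) (n : nat) (s : Q -> nat -> 'I_n) (j : nat) :
  (forall k, measurable [set q | s q j = k]) ->
  measurable_fun [set: (Q * n.-tuple bool)%type]
    (fun x => (tnth x.2 (s x.1 j))%:R : R).
Proof.
move=> ms; have -> : (fun x : Q * n.-tuple bool => (tnth x.2 (s x.1 j))%:R : R) =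
    (fun x => \sum_(k < n) (s x.1 j == k)%:R * (tnth x.2 k)%:R).
  apply/funext => x; rewrite (bigD1 (s x.1 j))//= eqxx mul1r big1 ?addr0//.
  by move=> k /negbTE kj; rewrite eq_sym kj mul0r.
apply: measurable_sum => k; apply: measurable_funM.
  exact: measurable_rank.
exact: measurable_relevance.
Qed.

Lemma utilityE (R : realType) (d : measure_display)
    (Q : measurableType d) (n : nat)
    (PQR : probability (Q * n.-tuple bool)%type R) (s : Q -> nat -> 'I_n) t :
  utility PQR s t =
    \int[PQR]_x (\sum_(j < t) (tnth x.2 (s x.1 j.+1))%:R).
Proof.
rewrite /utility unlock; congr fine; apply: eq_integral => x _.
by rewrite big_add1/= big_mkord.
Qed.

(** Given the request, averaging over the observation of the ranked item multiplies its weight by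
    its propensity. This cancels the inverse propensity and leaves the relevance. *)
Lemma ipw_gain_mean (d d' : measure_display) (Omega : measurableType d)
    (Q : measurableType d') (R : realType) (n : nat) (P : probability Omega R)
    (PQR : probability (Q * n.-tuple bool)%type R)
    (K : R.-pker (Q * n.-tuple bool)%type ~> n.-tuple bool)
    (X : {RV P >-> (Q * n.-tuple bool * n.-tuple bool)%type})
    (s : Q -> nat -> 'I_n) (t : nat) :
  has_logging_law PQR K X ->
  (forall j k, (0 < j <= t)%N -> measurable [set q | s q j = k]) ->
  (forall x j, (0 < j <= t)%N -> 0 < propensity K (s x.1 j) x) ->
  \int[P]_w ipw_gain K s t (X w) = utility PQR s t.
Proof.
move=> law ms p0; rewrite utilityE; congr fine.
pose B k := [set o : n.-tuple bool | tnth o k].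
have mB k : measurable (B k) by exact: measurable_tnth_true.
have mh (j : 'I_t) k : measurable_fun [set: (Q * n.-tuple bool)%type]
    (ipw_weight K s j.+1 k).
  by apply: measurable_ipw_weight; apply: ms; exact: ltn_ord.
have mX1 : measurable_fun [set: Omega] (fun w => (X w).1).
  exact: measurableT_comp.
have mX2 k : measurable_fun [set: Omega] (fun w => \1_(B k) (X w).2 : R).
  apply: (measurableT_comp (f := \1_(B k) : _ -> R)).
    exact: measurable_indic.
  exact: measurableT_comp.
(* All terms are nonnegative, so sums and integrals commute in the extended reals. *)
transitivity (\sum_(j < t) \sum_(k < n)
    \int[P]_w (ipw_weight K s j.+1 k (X w).1 * \1_(B k) (X w).2)%:E)%E.
  under eq_integral do rewrite ipw_gainE -sumEFin.
  have mjk (j : 'I_t) (k : 'I_n) : measurable_fun [set: Omega]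
      (fun w => (ipw_weight K s j.+1 k (X w).1 * \1_(B k) (X w).2)%:E).
    by apply/measurable_EFinP/measurable_funM => //; exact: measurableT_comp.
  have ge0jk (j : 'I_t) (k : 'I_n) w :
      (0 <= (ipw_weight K s j.+1 k (X w).1 * \1_(B k) (X w).2)%:E)%E.
    by rewrite lee_fin mulr_ge0 ?ipw_weight_ge0// indicE.
  rewrite ge0_integral_sum//.
  - apply: eq_bigr => j _; under eq_integral do rewrite -sumEFin.
    by rewrite ge0_integral_sum.
  - move=> j; under eq_fun do rewrite -sumEFin.
    exact: emeasurable_sum.
  - by move=> j w _; rewrite -sumEFin sume_ge0.
transitivity (\sum_(j < t) \sum_(k < n)
    \int[PQR]_x ((ipw_weight K s j.+1 k x)%:E * K x (B k)))%E.
  apply: eq_bigr => j _; apply: eq_bigr => k _.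
  apply: ge0_integral_composition => //; last exact: ipw_weight_ge0.
  by move=> A mA; exact: law.
have mK k : measurable_fun [set: _] (K ^~ (B k)) by exact: measurable_kernel.
have mjk (j : 'I_t) k : measurable_fun [set: _]
    (fun x => (ipw_weight K s j.+1 k x)%:E * K x (B k))%E.
  by apply: emeasurable_funM => //; exact/measurable_EFinP.
have ge0jk (j : 'I_t) (k : 'I_n) x :
    (0 <= (ipw_weight K s j.+1 k x)%:E * K x (B k))%E.
  by rewrite mule_ge0// lee_fin ipw_weight_ge0.
under eq_bigr => j _ do rewrite -ge0_integral_sum//.
rewrite -ge0_integral_sum//; last 2 first.
- by move=> j; exact: emeasurable_sum.
- by move=> j x _; exact: sume_ge0.
apply: eq_integral => x _; rewrite -sumEFin; apply: eq_bigr => j _.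
have pj := p0 x j.+1 (ltn_ord j).
(* Only the item at position [j.+1] survives in the inner sum. *)
rewrite (bigD1 (s x.1 j.+1))//= big1 ?adde0; last first.
  by move=> k /negbTE kj; rewrite /ipw_weight eq_sym kj mul0r mul0e.
rewrite -[K x _]fineK ?pkernel_fin_num// -EFinM /ipw_weight eqxx mul1r.
by rewrite mulrAC mulVf ?mul1r// gt_eqF.
Qed.

(** * Initial value and increments of the utility *)

Lemma utility0 (R : realType) (d : measure_display)
    (Q : measurableType d) (n : nat)
    (PQR : probability (Q * n.-tuple bool)%type R) (s : Q -> nat -> 'I_n) :
  utility PQR s 0 = 0.
Proof.
rewrite utilityE; under eq_Rintegral do rewrite big_ord0.
by rewrite Rintegral_cst// mul0r.
Qed.

Lemma utilityS_le (R : realType) (d : measure_display)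
    (Q : measurableType d) (n : nat)
    (PQR : probability (Q * n.-tuple bool)%type R) (s : Q -> nat -> 'I_n) t :
  (forall j k, (0 < j <= t.+1)%N -> measurable [set q | s q j = k]) ->
  utility PQR s t.+1 <= utility PQR s t + 1.
Proof.
move=> ms; rewrite !utilityE.
have mr j : (0 < j <= t.+1)%N -> measurable_fun [set: (Q * n.-tuple bool)%type]
    (fun x => (tnth x.2 (s x.1 j))%:R : R).
  by move=> jt; apply: measurable_ranked_relevance => k; exact: ms.
have r1 (x : Q * n.-tuple bool) j :
    `|(tnth x.2 (s x.1 j))%:R : R| <= 1.
  by rewrite normr_nat lern1; case: (tnth _ _).
under eq_Rintegral do rewrite big_ord_recr/=.
rewrite RintegralD//; last 2 first.
- apply: (@bounded_integrable _ _ _ _ t%:R).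
    by apply: measurable_sum => j; apply: mr => /=; rewrite ltnW// ltnS.
  move=> x; apply: le_trans (ler_norm_sum _ _ _) _.
  have -> : t%:R = \sum_(j < t) 1 :> R by rewrite sumr_const card_ord.
  by apply: ler_sum => j _.
- apply: (@bounded_integrable _ _ _ _ 1) => //.
  by apply: mr; rewrite leqnn.
rewrite lerD2l -[leRHS](Rintegral_probability_cst PQR).
apply: le_Rintegral => //.
- apply: (@bounded_integrable _ _ _ _ 1) => //.
  by apply: mr; rewrite leqnn.
- exact: (@bounded_integrable _ _ _ _ `|1|).
- by move=> x _; exact: le_trans (ler_norm _) (r1 x _).
Qed.

(** * Inactive clipping and almost sure convergence of the lower bounds *)

Lemma clipped_gain_ipw (d : measure_display) (Q : measurableType d)
    (R : realType) (n : nat)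
    (K : R.-pker (Q * n.-tuple bool)%type ~> n.-tuple bool)
    (s : Q -> nat -> 'I_n) (t : nat) (gamma lambda : R) :
  0 < gamma -> gamma^-1 <= lambda ->
  (forall x j, (0 < j <= t)%N -> gamma < propensity K (s x.1 j) x) ->
  clipped_gain K s lambda t = ipw_gain K s t.
Proof.
move=> g0 gl gp; apply/funext => y; rewrite /clipped_gain /ipw_gain.
apply: eq_big_nat => j jt; have gpj := gp y.1 j jt.
congr (_ * _); apply/min_idPr; apply: le_trans gl.
by rewrite lef_pV2 ?posrE ?ltW//; exact: lt_trans gpj.
Qed.

Lemma utility_lower_bound_cvg (d d' : measure_display)
    (Omega : measurableType d) (Q : measurableType d') (R : realType) (n : nat)
    (P : probability Omega R) (PQR : probability (Q * n.-tuple bool)%type R)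
    (K : R.-pker (Q * n.-tuple bool)%type ~> n.-tuple bool)
    (X : nat -> {RV P >-> (Q * n.-tuple bool * n.-tuple bool)%type})
    (s : Q -> nat -> 'I_n) (t : nat) (gamma a : R) :
  (forall i, has_logging_law PQR K (X i)) -> mutually_independent X ->
  (forall j k, (0 < j <= t)%N -> measurable [set q | s q j = k]) ->
  0 < gamma ->
  (forall x j, (0 < j <= t)%N -> gamma < propensity K (s x.1 j) x) ->
  {ae P, forall w,
    utility_lower_bound K s (Num.sqrt m%:R) m (fun i => X i w) t a
      @[m --> \oo] --> utility PQR s t}.
Proof.
move=> law indX ms g0 gp.
have ipwB := ipw_gain_bound g0 gp.
have mean i : \int[P]_w ipw_gain K s t (X i w) = utility PQR s t.
  by apply: ipw_gain_mean => // x j jt; exact: lt_trans (gp x j jt).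
have := mutually_independent_slln indX (measurable_ipw_gain K ms) ipwB mean.
apply: filterS => w cvgw.
have := lower_bound_cvg (ln (2 / a)) t (fun i => ipwB (X i w)) cvgw.
apply: cvg_trans; apply: near_eq_cvg.
(* Past the square of [gamma^-1], the clipping level [Num.sqrt m%:R] is at least [gamma^-1], so
   clipped and unclipped gains coincide. *)
exists (Num.truncn (gamma^-1 ^+ 2)).+1 => // m /= mg.
rewrite /utility_lower_bound (clipped_gain_ipw g0 _ gp)//.
rewrite -[gamma^-1]ger0_norm ?invr_ge0 ?(ltW g0)// -sqrtr_sqr ler_wsqrtr//.
by apply: ltW; apply: lt_le_trans (truncnS_gt _) _; rewrite ler_nat.
Qed.

(** * Limiting behaviour of the selected threshold *)

Theorem proposition4p7 (R : realType)
  (* items, groups of items, queries, relevance model *)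
  (D : Type) (n : nat) (item : 'I_n -> D)
  (G : Type) (members : G -> {set 'I_n})
  (dQ : measure_display) (Q : measurableType dQ)
  (f : Q -> D -> R) (f01 : forall q x, 0 <= f q x <= 1)
  (* rankings: sigma g q j is the index of the item of g at position j *)
  (sigma : G -> Q -> nat -> 'I_n)
  (sigma_ranking : forall g q,
     is_ranking (members g) (fun k => f q (item k)) (sigma g q))
  (sigma_measurable : forall g j k, (0 < j <= #|members g|)%N ->
     measurable [set q | sigma g q j = k])
  (tmax : G -> nat)
  (tmax_bounds : forall g, (0 < tmax g <= #|members g|)%N)
  (Ustar : G -> R)
  (* distribution of requests, conditional law of the observations *)
  (PQR : probability (Q * n.-tuple bool)%type R)
  (K : R.-pker (Q * n.-tuple bool)%type ~> n.-tuple bool)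
  (* logged data: X i = ((Q_i, R_i), O_i) *)
  (dO : measure_display) (Omega : measurableType dO) (P : probability Omega R)
  (X : nat -> {RV P >-> (Q * n.-tuple bool * n.-tuple bool)%type})
  (X_law : forall i, has_logging_law PQR K (X i))
  (X_indep : mutually_independent X)
  (* assumptions (i) and (ii) *)
  (target : forall g,
     Ustar g <= utility PQR (sigma g) (tmax g) /\ 0 < Ustar g)
  (overlap : exists gamma : R, 0 < gamma /\
     forall g (q : Q) (r : n.-tuple bool) j, (0 < j <= tmax g)%N ->
       gamma < propensity K (sigma g q j) (q, r))
  (* the selection rule *)
  (rule : nat -> R -> R -> (nat -> R -> R) -> nat)
  (rule_def : rule = @union_threshold R \/ rule = @mono_threshold R)
  (g : G) (alpha : R) (alpha01 : 0 < alpha < 1) :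
  let U := utility PQR (sigma g) in
  let that (m : nat) (w : Omega) :=
    rule (tmax g) (Ustar g) alpha
      (utility_lower_bound K (sigma g) (Num.sqrt m%:R) m (fun i => X i w)) in
  {ae P, forall w, forall delta : R, 0 < delta ->
    exists c : R, 0 < c /\ forall m : nat, c < m%:R ->
      [/\ Ustar g - delta < U (that m w),
          U (that m w) < 1 + Ustar g + delta
        & U (that m w - 1)%N < Ustar g + delta]}.
Proof.
move=> U that.
have [gamma [g0 gp]] := overlap.
have [T0 Tm] := andP (tmax_bounds g).
have [UT U0] := target g.
(* The two rules differ from here on only in the level [a] at which the bound is taken, and the
   bound has the same limit at every level. *)
have [a rule_spec] : exists a : R, forall L : nat -> R -> R,
    threshold_property (tmax g) (Ustar g) (L ^~ a)
      (rule (tmax g) (Ustar g) alpha L).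
  case: rule_def => ->.
    by exists (alpha / ((tmax g)%:R - 1)) => L; exact: union_threshold_property.
  by exists alpha => L; exact: mono_threshold_property.
have ms t : (t <= tmax g)%N -> forall j k, (0 < j <= t)%N ->
    measurable [set q | sigma g q j = k].
  move=> tT j k /andP[j0 jt]; apply: sigma_measurable.
  by rewrite j0 (leq_trans jt)// (leq_trans tT).
have gp' t : (t <= tmax g)%N -> forall (x : Q * n.-tuple bool) j,
    (0 < j <= t)%N -> gamma < propensity K (sigma g x.1 j) x.
  move=> tT [q r] j /andP[j0 jt]; apply: gp.
  by rewrite j0 (leq_trans jt).
pose L m w t := utility_lower_bound K (sigma g) (Num.sqrt m%:R) m
  (fun i => X i w) t a.
have : {ae P, forall w, forall t, (t <= tmax g)%N ->
    L m w t @[m --> \oo] --> U t}.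
  (* Each threshold has its own null set, and their countable union is null; beyond [tmax g] the
     claim is vacuous. *)
  apply: ae_foralln => t; have [tT|tT] := leqP t (tmax g); last first.
    by apply: aeW => w.
  have := utility_lower_bound_cvg a X_law X_indep (ms t tT) g0 (gp' t tT).
  by apply: filterS => w.
apply: filterS => w cvgw delta d0.
(* Finitely many thresholds allow one [N] for all of them, so the estimate can be used at the random
   threshold, which changes with [m]. *)
have [N _ NL] : \forall m \near \oo, forall t : 'I_(tmax g).+1,
    `|U t - L m w t| < delta.
  apply: filter_forall => t; have /cvgrPdist_lt := cvgw t (ltn_ord t).
  exact.
(* The successor makes the witness positive even when [N] is 0. *)
exists N.+1%:R; split=> // m; rewrite ltr_nat => Nm.
have UL t : (t <= tmax g)%N -> `|U t - L m w t| < delta.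
  by move=> tT; exact: (NL m (ltnW (ltnW Nm)) (Ordinal (tT : (t < _.+1)%N))).
have [] : threshold_property (tmax g) (Ustar g) (L m w) (that m w).
  exact: rule_spec.
move: (that m w) => t /andP[t0 tT] tL t1L.
(* If [1 < t], the bound at [t - 1] is below the target and within [delta] of [U (t - 1)]. If
   [t = 1], then [U 0 = 0] is below the positive target. *)
have U1 : U (t - 1)%N < Ustar g + delta.
  have [t1|t1] := ltnP 1 t.
    have := UL (t - 1)%N (leq_trans (leq_subr _ _) tT).
    by rewrite ltr_norml => /andP[_]; have := t1L t1; lra.
  have -> : t = 1%N by apply/eqP; rewrite eqn_leq t1.
  by rewrite subnn /U utility0; lra.
split=> //.
  (* Below [tmax g] the bound reaches the target; at the default value [tmax g], the assumption [UT]
     takes its place. *)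
  have [tT'|Tt] := ltnP t (tmax g).
    by have := UL t tT; rewrite ltr_norml => /andP[+ _]; have := tL tT'; lra.
  have -> : t = tmax g by apply/eqP; rewrite eqn_leq tT.
  by rewrite /U; lra.
have := @utilityS_le _ _ _ _ PQR (sigma g) (t - 1)%N.
rewrite subn1 prednK// -subn1 => /(_ (ms t tT)); rewrite -!/(U _); lra.
Qed.
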